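(* Let $\mathcal{H}$ be a real Hilbert space and let $f:\mathcal{H}\to\mathbb{R}$ be convex and differentiable with $L$-Lipschitz continuous gradient $\nabla f$ and $\mathcal{S}=\arg\min_{\mathcal{H}} f\neq\emptyset$; let $x^*$ be the minimum-norm element of $\mathcal{S}$. Let $\delta>0$, $s>0$, let $(\varepsilon_k)_k$ be a nonincreasing positive sequence with $\varepsilon_k\to 0$, and let $(x_k)_k$ be generated from $x_0,x_1\in\mathcal{H}$ by, for $k\ge1$, $$y_k=x_k+(1-\delta\sqrt{s\varepsilon_k})(x_k-x_{k-1}),\qquad x_{k+1}=y_k-s\big(\nabla f(y_k)+\varepsilon_k y_k\big).$$ Assume that there are $k_0\in\mathbb{N}$ and positive parameters $a,b,q,\lambda$ with $\lambda<\delta$ such that for all $k\ge k_0$: (i) $(1+q)\Big(\frac{1}{\sqrt{s\varepsilon_{k+1}}}-\frac{1}{\sqrt{s\varepsilon_k}}+\frac{\delta}{1-\delta\sqrt{s\varepsilon_k}}-\lambda\Big)-\lambda\sqrt{\frac{\varepsilon_{k+1}}{\varepsilon_k}}\le 0$; (ii) $\frac{1-b}{b}\lambda^2+\frac{\delta\lambda}{1-\delta\sqrt{s\varepsilon_k}}-1\le 0$; (iii) $\frac{(1+a(1-q))\lambda}{a}-\delta+(1+q)\Big(\frac{1}{\sqrt{s\varepsilon_{k+1}}}-\frac{1}{\sqrt{s\varepsilon_k}}\Big)+\frac{q\delta^2\sqrt{s\varepsilon_{k+1}}}{1-\delta\sqrt{s\varepsilon_k}}\le 0$; (iv) $Ls\big(1+\lambda\sqrt{s\varepsilon_{k+1}}\big)+q\big((L+\varepsilon_k)s-1\big)\le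 0$. Let $E_k$ be the energy defined in the context. Then, for all $k\ge k_0$, $$E_{k+1}-E_k+\mu_{k+1}E_{k+1}\le \frac{\theta_k}{2}\|x^*\|^2,$$ where $(\mu_k)_k$ and $(\theta_k)_k$ are given by $$\mu_{k+1}=\frac{\sqrt{\varepsilon_k}-\sqrt{\varepsilon_{k+1}}}{\sqrt{\varepsilon_{k+1}}}+\Big(\frac{\delta}{1-\delta\sqrt{s\varepsilon_k}}-\lambda\Big)\sqrt{s\varepsilon_k},$$ $$\theta_k=(a+b)\lambda\sqrt{s\varepsilon_k}\,\frac{(\varepsilon_k-\varepsilon_{k-1})^2}{\varepsilon_{k-1}^2}-\frac{(1+q)s(\varepsilon_{k+1}-\varepsilon_k)}{(1-\delta\sqrt{s\varepsilon_k})(1-s\varepsilon_k)}(1+\mu_{k+1}).$$ Moreover, setting $\gamma_k=\prod_{j=k_0}^k(1+\mu_j)$ for $k\ge k_0$, one has $$E_{k+1}\le\frac{\gamma_{k_0}}{\gamma_{k+1}}E_{k_0}+\frac{1}{2\gamma_{k+1}}\Big(\sum_{j=k_0}^k\gamma_j\theta_j\Big)\|x^*\|^2\qquad (k\ge k_0).$$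
   Context: For each index $k$ let $\varphi_k(x)=f(x)+\frac{\varepsilon_k}{2}\|x\|^2$ and let $x_{\varepsilon_k}$ be the unique minimizer of $\varphi_k$ over $\mathcal{H}$. The energy is $$E_k=\alpha_k\big(\varphi_k(x_k)-\varphi_k(x_{\varepsilon_k})\big)+\tfrac12\big\|\tau_k(x_k-x_{\varepsilon_{k-1}})+(x_k-x_{k-1})\big\|^2+\tfrac{\beta_k}{2}\|x_k-x_{k-1}\|^2,$$ with $$\tau_k=\lambda\sqrt{s\varepsilon_k},\qquad \beta_k=q(1-\delta\sqrt{s\varepsilon_k}),\qquad \alpha_k=\frac{(1+q)s}{(1-\delta\sqrt{s\varepsilon_k})(1-s\varepsilon_k)}.$$
   Formalization: Assumes δ√(sε_k)<1 for k≥k0 (false otherwise: f=0, s=1, q=10, δ=1.001√2, λ=.95δ, ε_0=ε_1=ε_2=1/2, √ε_3=.0245, x_0=-1, x_1=0, k0=1); the last bound also assumes δ√(sε_{k0-1})<1, removable by using k0+1 and one step; L>0 and k0≥1 are required. *)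

(* Defs.v *)
From HB Require Import structures.
From mathcomp Require Import all_boot all_order all_algebra.
From mathcomp Require Import all_classical all_reals all_analysis.
Import Order.TTheory GRing.Theory Num.Theory numFieldNormedType.Exports.

Set Implicit Arguments.
Unset Strict Implicit.
Unset Printing Implicit Defensive.

Local Open Scope classical_set_scope.
Local Open Scope ring_scope.

Definition argmin (R : realType) (T : Type) (g : T -> R) : set T :=
  [set z | forall y, g z <= g y].

Definition min_norm_elts (R : realType) (V : normedModType R) (A : set V)
    : set V :=
  [set z | A z /\ forall y, A y -> `|z| <= `|y|].

Section Hilbert.
Context {R : realType} {H : completeNormedModType R}.

(* A real Hilbert space is a complete normed module [H] together with a
   symmetric positive definite bilinear form which induces its norm. *)
Definition induces_norm (ip : {dot H for idfun}) : Prop :=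
  forall u : H, ip u u = `|u| ^+ 2.

(* [g x] is the Riesz representative of the Frechet differential at [x]. *)
Definition is_gradient (ip : {dot H for idfun}) (f : H -> R) (g : H -> H)
    : Prop :=
  forall x : H, differentiable f x /\ forall v : H, 'd f x v = ip (g x) v.

Definition tikhonov (f : H -> R) (e : R) (z : H) : R :=
  f z + e / 2 * `|z| ^+ 2.

Definition is_trajectory (gradf : H -> H) (delta s : R) (eps : nat -> R)
    (x : nat -> H) : Prop :=
  forall k : nat, (1 <= k)%N ->
    let y := x k + (1 - delta * Num.sqrt (s * eps k)) *: (x k - x k.-1) in
    x k.+1 = y - s *: (gradf y + eps k *: y).

End Hilbert.

(* Indices start at 0.  The terms below which involve [k.-1] are meaningful
   for [1 <= k] only. *)
Section Energy.
Context {R : realType}.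
Context (delta s a b q lambda : R) (eps : nat -> R).

Definition tau (k : nat) : R := lambda * Num.sqrt (s * eps k).

Definition beta (k : nat) : R := q * (1 - delta * Num.sqrt (s * eps k)).

Definition alpha (k : nat) : R :=
  (1 + q) * s / ((1 - delta * Num.sqrt (s * eps k)) * (1 - s * eps k)).

Definition energy {H : completeNormedModType R} (f : H -> R) (x xeps : nat -> H)
    (k : nat) : R :=
  alpha k * (tikhonov f (eps k) (x k) - tikhonov f (eps k) (xeps k))
  + 2^-1 * `|tau k *: (x k - xeps k.-1) + (x k - x k.-1)| ^+ 2
  + beta k / 2 * `|x k - x k.-1| ^+ 2.

Definition mu (k : nat) : R :=
  (Num.sqrt (eps k.-1) - Num.sqrt (eps k)) / Num.sqrt (eps k)
  + (delta / (1 - delta * Num.sqrt (s * eps k.-1)) - lambda)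
    * Num.sqrt (s * eps k.-1).

Definition theta (k : nat) : R :=
  (a + b) * lambda * Num.sqrt (s * eps k)
    * ((eps k - eps k.-1) ^+ 2 / eps k.-1 ^+ 2)
  - (1 + q) * s * (eps k.+1 - eps k)
    / ((1 - delta * Num.sqrt (s * eps k)) * (1 - s * eps k))
    * (1 + mu k.+1).

Definition gam (k0 k : nat) : R := \prod_(k0 <= j < k.+1) (1 + mu j).

End Energy.

(* Main.v *)
(** With g = grad phi_k(y_k), Q = x_{k+1} - x_{eps_k} and v = x_{k+1} - x_k, the
   vectors w_k whose squared norms enter the energy satisfy
     w_{k+1} = tau_{k+1} Q + v,
     w_k - w_{k+1} = m1 tau_{k+1} Q + m2 v + (s / eta) g + tau_k d,
   where eta = 1 - delta sqrt(s eps_k), d = x_{eps_k} - x_{eps_{k-1}} and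
   m1 + m2 = mu_{k+1}.  Bounding |w_k|^2 from below by its tangent at w_{k+1}
   produces the terms <g, Q> and <g, v>, which are the ones given by the descent
   inequality for phi_k at x_{eps_k} and at x_k with weights proportional to
   tau_{k+1} and 1 + q.  Conditions (ii), (iii) and (iv) then say that the
   coefficients of |Q|^2, |v|^2 and |g|^2 are nonpositive, and (i) compares the
   weight mu_{k+1} with tau_{k+1}.  What is left is the drift d of the viscosity
   curve, controlled by |x*| through the monotonicity of grad f. *)
Require Import Defs.
From HB Require Import structures.
From mathcomp Require Import all_boot all_order all_algebra.
From mathcomp Require Import all_classical all_reals all_analysis.
From mathcomp Require Import unstable ring lra.
Import Order.TTheory GRing.Theory Num.Theory numFieldNormedType.Exports.

Local Open Scope classical_set_scope.
Local Open Scope ring_scope.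

(** * Inner product calculus *)

Section InnerProduct.
Context {R : realType} {H : completeNormedModType R}.
Context {ip : {dot H for idfun}} (ip_norm : induces_norm ip).

Lemma ipC (u v : H) : ip u v = ip v u.
Proof. by rewrite hermC /= expr0 mul1r. Qed.

Lemma ipZl (c : R) (u v : H) : ip (c *: u) v = c * ip u v.
Proof. exact: linearZl_LR. Qed.

Lemma ipDl (u v w : H) : ip (u + v) w = ip u w + ip v w.
Proof. exact: linearDl. Qed.

Lemma ipNl (u v : H) : ip (- u) v = - ip u v.
Proof. exact: linearNl. Qed.

Lemma ipZr (c : R) (u v : H) : ip u (c *: v) = c * ip u v.
Proof. by rewrite ipC ipZl ipC. Qed.

Lemma ipDr (u v w : H) : ip w (u + v) = ip w u + ip w v.
Proof. exact: linearDr. Qed.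

Lemma ipNr (u v : H) : ip v (- u) = - ip v u.
Proof. exact: linearNr. Qed.

Lemma ip_norm2 (u : H) : `|u| ^+ 2 = ip u u.
Proof. by rewrite ip_norm. Qed.

Definition ipE := (ipDl, ipDr, ipNl, ipNr, ipZl, ipZr).

(** Cauchy-Schwarz: the squared norm of |v| u - |u| v equals 2 |u| |v| (|u| |v| - <u, v>). *)
Lemma ip_le_norm (u v : H) : ip u v <= `|u| * `|v|.
Proof.
have [->|u0] := eqVneq u 0.
  by rewrite -(scale0r 0) ipZl mul0r normrZ normr0 !mul0r.
have [->|v0] := eqVneq v 0.
  by rewrite -(scale0r 0) ipZr mul0r normrZ normr0 mul0r mulr0.
have uv_gt0 : 0 < `|u| * `|v| by rewrite mulr_gt0 ?normr_gt0.
have : 0 <= ip (`|v| *: u - `|u| *: v) (`|v| *: u - `|u| *: v).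
  by rewrite ip_norm sqr_ge0.
rewrite !ipE (ipC v u) !ip_norm => h.
rewrite -(ler_pM2l uv_gt0); nra.
Qed.

Lemma norm2_ge_tangent (w w' : H) :
  `|w'| ^+ 2 + 2 * ip w' (w - w') <= `|w| ^+ 2.
Proof.
have : 0 <= `|w - w'| ^+ 2 by rewrite sqr_ge0.
rewrite !ip_norm2 !ipE (ipC w w'); lra.
Qed.

End InnerProduct.

(** * First-order inequalities for [f] and its Tikhonov regularizations *)

Section Gradient.
Context {R : realType} {H : completeNormedModType R}.
Context {ip : {dot H for idfun}} (ip_norm : induces_norm ip).
Context {f : H -> R} {gradf : H -> H} {L : R}.
Context (f_grad : is_gradient ip f gradf).
Context (L_gt0 : 0 < L) (gradf_lip : L.-lipschitz gradf).

Lemma is_derive_line (y p : H) (t : R) :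
  is_derive t 1 (fun t : R => f (t *: p + y)) (ip (gradf (t *: p + y)) p).
Proof.
have [df fE] := f_grad (t *: p + y).
have df' : differentiable (fun t : R => f (t *: p + y)) t.
  by apply: differentiable_comp.
apply: DeriveDef; first exact: diff_derivable.
rewrite deriveE //.
have -> : (fun t : R => f (t *: p + y)) = f \o (fun t : R => t *: p + y) by [].
rewrite diff_comp //= -fE; congr ('d f _ _).
have dl : is_diff t (fun t : R => t *: p + y) (fun t : R => t *: p).
  by apply: is_diff_eq; rewrite addr0.
by rewrite diff_val scale1r.
Qed.

Lemma ip_grad_le (y p : H) (t : R) : 0 <= t ->
  `|ip (gradf (t *: p + y)) p - ip (gradf y) p| <= L * t * `|p| ^+ 2.
Proof.
move=> t0.
have lip : `|gradf (t *: p + y) - gradf y| <= L * (t * `|p|).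
  have := gradf_lip (t *: p + y, y) (conj I I).
  by rewrite /= addrK normrZ ger0_norm.
have p0 := normr_ge0 p.
rewrite -ipNl -ipDl ler_norml; apply/andP; split.
  rewrite lerNl -ipNl; apply: le_trans (ip_le_norm ip_norm _ _) _.
  rewrite normrN; nra.
apply: le_trans (ip_le_norm ip_norm _ _) _; nra.
Qed.

(* The derivative of [t |-> f (y + t p) - t <grad f y, p> - L t^2 |p|^2 / 2]
   is nonpositive on [0, 1] because [gradf] is [L]-Lipschitz; the lower bound
   is the same argument with the opposite sign of [L]. *)
Lemma quadratic_bound (y p : H) :
  `|f (p + y) - f y - ip (gradf y) p| <= L / 2 * `|p| ^+ 2.
Proof.
pose A := ip (gradf y) p.
pose h (c : R) : R -> R :=
  (fun t : R => f (t *: p + y)) - A *: id + c *: (id ^+ 2).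
pose dh (c t : R) := ip (gradf (t *: p + y)) p - A + c * (2 * t).
have hE c t : h c t = f (t *: p + y) - A * t + c * t ^+ 2 by [].
have dhP (c t : R) : is_derive t 1 (h c) (dh c t).
  have dA := is_deriveZ A (is_derive_id t 1).
  have dc := is_deriveZ c (is_deriveX 2 (is_derive_id t 1)).
  apply: is_derive_eq (is_deriveD (is_deriveB (is_derive_line y p t) dA) dc) _.
  by rewrite /dh /= !scaler1 /GRing.scale /= expr1; ring.
have mvt (c : R) : exists2 t, t \in `]0, 1[ & h c 1 - h c 0 = dh c t.
  have hc : {within `[0, 1], continuous (h c)}.
    apply: continuous_subspaceT => t; apply: differentiable_continuous.
    by apply/derivable1_diffP; case: (dhP c t).
  have [t ht ->] := MVT ltr01 (fun t _ => dhP c t) hc.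
  by exists t => //; rewrite subr0 mulr1.
pose C := L / 2 * `|p| ^+ 2.
have [t1 + e1] := mvt C; have [t2 + e2] := mvt (- C).
rewrite !in_itv /= => /andP[/ltW t2_ge0 _] /andP[/ltW t1_ge0 _].
have := ip_grad_le y p _ t1_ge0; have := ip_grad_le y p _ t2_ge0.
rewrite !ler_norml -/A -/C => /andP[_ b2] /andP[b1 _].
move: e1 e2; rewrite !hE !scale1r !scale0r !add0r /dh => e1 e2.
have C2 : C = L * `|p| ^+ 2 / 2 by rewrite /C; ring.
apply/andP; split; nra.
Qed.

(** Convexity on the segment, compared with [quadratic_bound], leaves after division by [t] an error
    of order [t], which vanishes as [t] tends to 0. *)
Lemma convex_ge_tangent (y w : H) :
  convex_function [set: convex_lmodType H] f ->
  f y + ip (gradf y) (w - y) <= f w.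
Proof.
move=> f_convex; set p := w - y; rewrite -lerBrDl.
set A := ip (gradf y) p; set B := f w - f y.
have key (t : R) : 0 < t -> t < 1 -> A - B <= L / 2 * `|p| ^+ 2 * t.
  move=> t0 t1.
  have := f_convex (Itv01 (ltW t0) (ltW t1)) w y (mem_set I) (mem_set I).
  have -> : conv (Itv01 (ltW t0) (ltW t1)) (w : convex_lmodType H) y
      = t *: p + y.
    rewrite /conv /= /onem scalerBr scalerBl scale1r.
    by rewrite -addrA (addrC _ y).
  rewrite convRE /= /onem => cv.
  have /ler_normlP[qb _] := quadratic_bound y (t *: p).
  move: qb; rewrite ipZr -/A normrZ (gtr0_norm t0) => qb.
  rewrite -(ler_pM2l t0) /B; nra.
rewrite leNgt; apply/negP => AB.
have C0 : 0 <= L / 2 * `|p| ^+ 2 by rewrite mulr_ge0 ?sqr_ge0// divr_ge0// ltW.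
set C := L / 2 * _ in key C0.
have D0 : 0 < A - B by rewrite subr_gt0.
have DC0 : 0 < A - B + C + 1 by lra.
(* A point of (0, 1), also when [C] is 0, at which [key] becomes [A - B + C + 1 <= C] once the
   factor [A - B] is cancelled. *)
have := key ((A - B) / (A - B + C + 1)).
rewrite divr_gt0// ltr_pdivrMr// mul1r => /(_ isT).
have -> : A - B < A - B + C + 1 by lra.
move/(_ isT); rewrite mulrA ler_pdivlMr//; nra.
Qed.

(* Minimality is tested against a gradient step of length 1 / (L + e). *)
Lemma grad_tikhonov_argmin (e : R) (z : H) : 0 < e ->
  argmin (tikhonov f e) z -> gradf z = - (e *: z).
Proof.
move=> e0 zmin; apply/eqP; rewrite -addr_eq0 -normr_eq0 -sqrf_eq0; apply/eqP.
have [p pE] : exists p, p = gradf z + e *: z by eexists.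
rewrite -pE.
have Le0 : 0 < L + e by rewrite addr_gt0.
set t := (L + e)^-1.
have t0 : 0 < t by rewrite invr_gt0.
have := zmin (- t *: p + z).
have /ler_normlP[_] := quadratic_bound z (- t *: p).
rewrite /tikhonov normrZ normrN (gtr0_norm t0) !(ip_norm2 ip_norm).
have -> : gradf z = p - e *: z by rewrite pE addrK.
rewrite !(ipE, exprMn) (ipC z p) => h1 h2.
have h3 : t * (2 - t * (L + e)) * ip p p <= 0.
  by move: h1 h2; rewrite -?(ip_norm2 ip_norm); nra.
have p0 : 0 <= ip p p by rewrite ip_norm sqr_ge0.
have h4 : t * (L + e) = 1 by rewrite /t mulVf // gt_eqF.
apply/eqP; rewrite eq_le p0 andbT -(pmulr_rle0 _ t0).
move: h3; rewrite h4; lra.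
Qed.

(** Adding the two minimality inequalities cancels [f]. The whole viscosity curve thus stays in the
    ball of radius |xstar|. *)
Lemma tikhonov_argmin_norm (e : R) (z xstar : H) : 0 < e ->
  argmin f xstar -> argmin (tikhonov f e) z -> `|z| <= `|xstar|.
Proof.
move=> e0 /(_ z) fz /(_ xstar); rewrite /tikhonov => tz.
rewrite -(ler_pXn2r (n := 2)) ?nnegrE//; nra.
Qed.

(* Monotonicity of [gradf] at [gradf z = - e z] and [gradf z' = - e' z']. *)
Lemma tikhonov_argmin_dist (e e' : R) (z z' : H) :
  convex_function [set: convex_lmodType H] f ->
  0 < e -> e <= e' -> argmin (tikhonov f e) z -> argmin (tikhonov f e') z' ->
  e' * `|z - z'| <= (e' - e) * `|z|.
Proof.
move=> f_convex e0 ee' zmin zmin'.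
have e0' := lt_le_trans e0 ee'.
have := convex_ge_tangent z z' f_convex.
have := convex_ge_tangent z' z f_convex.
rewrite (grad_tikhonov_argmin e z)// (grad_tikhonov_argmin e' z')//.
have [->|d0] := eqVneq z z'.
  by rewrite subrr normr0 mulr0 => _ _; rewrite mulr_ge0// subr_ge0.
have dgt0 : 0 < `|z - z'| by rewrite normr_gt0 subr_eq0.
have cs := ip_le_norm ip_norm z (z - z').
have n2 := ip_norm2 ip_norm (z - z').
move: cs n2; rewrite !ipE (ipC z' z) => cs n2 h1 h2.
have ee := subr_ge0 e e'; rewrite ee' in ee.
(* Monotonicity reads e' |z - z'|^2 <= (e' - e) <z, z - z'>, and Cauchy-Schwarz leaves the common
   factor |z - z'|. *)
rewrite -(ler_pM2r dgt0); nra.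
Qed.

(* The identity [gradf y = (1 - s e) g - e x'] lets the quadratic part of
   [tikhonov f e] be expanded at the new point [x'] instead of [y]. *)
Lemma tikhonov_gradient_step (e s : R) (y g x' w : H) :
  convex_function [set: convex_lmodType H] f ->
  g = gradf y + e *: y -> x' = y - s *: g ->
  tikhonov f e x' - tikhonov f e w
    <= (1 - s * e) * ip g (x' - w) + L * s ^+ 2 / 2 * `|g| ^+ 2
       - e / 2 * `|x' - w| ^+ 2.
Proof.
move=> f_convex gE x'E.
have := convex_ge_tangent y w f_convex.
have /ler_normlP[_] := quadratic_bound y (- (s *: g)).
rewrite (addrC _ y) normrN normrZ exprMn real_normK ?num_real// -x'E.
have {gE} -> : gradf y = g - e *: y by rewrite gE addrK.
have {x'E} -> : y = x' + s *: g by rewrite x'E subrK.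
rewrite /tikhonov !(ip_norm2 ip_norm) !ipE (ipC w x') (ipC x' g).
lra.
Qed.

End Gradient.

(** * One step of the energy estimate *)

(* Here [r = sqrt (s eps_k)] and [r' = sqrt (s eps_(k+1))], so that
   [(1 + q) * kappa = alpha_k] and [m1 + m2 = mu_(k+1)]. *)
Section EnergyStep.
Context {R : realType} (delta s L e a b q lambda r r' : R).
Context (delta_gt0 : 0 < delta) (s_gt0 : 0 < s) (L_gt0 : 0 < L) (e_gt0 : 0 < e).
Context (a_gt0 : 0 < a) (b_gt0 : 0 < b) (q_gt0 : 0 < q).
Context (lambda_gt0 : 0 < lambda) (lambda_lt : lambda < delta).
Context (r'_gt0 : 0 < r') (r'_le : r' <= r) (rE : r ^+ 2 = s * e).
Context (dr_lt1 : delta * r < 1).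

Let eta := 1 - delta * r.
Let kappa := s / (eta * (1 - s * e)).
Let m1 := (r - r') / r'.
Let m2 := (delta / eta - lambda) * r.

Context (cond_i :
  (1 + q) * (1 / r' - 1 / r + delta / eta - lambda) - lambda * (r' / r) <= 0).
Context (cond_ii : (1 - b) / b * lambda ^+ 2 + delta * lambda / eta - 1 <= 0).
Context (cond_iii :
  (1 + a * (1 - q)) * lambda / a - delta + (1 + q) * (1 / r' - 1 / r)
  + q * delta ^+ 2 * r' / eta <= 0).
Context (cond_iv : L * s * (1 + lambda * r') + q * ((L + e) * s - 1) <= 0).

Let r_gt0 : 0 < r. Proof. exact: lt_le_trans r'_gt0 r'_le. Qed.
Let eta_gt0 : 0 < eta. Proof. by rewrite subr_gt0. Qed.
Let eta_le1 : eta <= 1.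
Proof. by rewrite lerBlDr lerDl mulr_ge0// ltW. Qed.
Let r_neq0 : r != 0. Proof. by rewrite gt_eqF. Qed.
Let r'_neq0 : r' != 0. Proof. by rewrite gt_eqF. Qed.
Let eta_neq0 : eta != 0. Proof. by rewrite gt_eqF. Qed.
Let a_neq0 : a != 0. Proof. by rewrite gt_eqF. Qed.
Let b_neq0 : b != 0. Proof. by rewrite gt_eqF. Qed.

Lemma step_lt1 : s * e < 1.
Proof.
have : 0 < L * s * (1 + lambda * r').
  by rewrite !mulr_gt0// addr_gt0// mulr_gt0.
move=> Ls_gt0; have : q * ((L + e) * s - 1) < 0 by move: cond_iv; lra.
rewrite pmulr_rlt0// => ?; have : 0 < L * s by rewrite mulr_gt0.
lra.
Qed.

Let se_gt0 : 0 < 1 - s * e. Proof. by rewrite subr_gt0 step_lt1. Qed.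

Let m1_ge0 : 0 <= m1.
Proof. by rewrite divr_ge0 ?subr_ge0// ltW. Qed.

Lemma delta_div_ge : lambda <= delta / eta.
Proof.
by rewrite ler_pdivlMr// (le_trans _ (ltW lambda_lt))// ger_pMr.
Qed.

Let m2_ge0 : 0 <= m2.
Proof. by rewrite mulr_ge0 ?subr_ge0 ?delta_div_ge// ltW. Qed.

Let kappa_gt0 : 0 < kappa.
Proof. by rewrite divr_gt0// mulr_gt0. Qed.

(** Condition (i) times [r]. *)
Lemma weight_le : (1 + q) * (m1 + m2) <= lambda * r'.
Proof.
have := mulr_le0_ge0 cond_i (ltW r_gt0).
have -> : ((1 + q) * (1 / r' - 1 / r + delta / eta - lambda)
           - lambda * (r' / r)) * r = (1 + q) * (m1 + m2) - lambda * r'.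
  by rewrite /m1 /m2; field; rewrite r_neq0 r'_neq0 eta_neq0.
by rewrite subr_le0.
Qed.

(** Condition (ii) times [r * r'] bounds the first two terms by [r * r'], and [kappa * e >= r ^+ 2]
    because [r ^+ 2 = s * e] and [eta * (1 - s * e) <= 1]. *)
Lemma coef_QQ_le0 :
  (m2 - m1) * (lambda * r') + lambda * r * (lambda * r') / b - kappa * e <= 0.
Proof.
have ke : r ^+ 2 <= kappa * e.
  rewrite /kappa rE mulrAC ler_pdivlMr ?mulr_gt0//.
  rewrite ger_pMr ?mulr_gt0//.
  have : 0 < s * e by rewrite mulr_gt0.
  move: eta_gt0 eta_le1 se_gt0; nra.
have rr' : 0 < r * r' by rewrite mulr_gt0.
have h : (m2 - m1) * (lambda * r') + lambda * r * (lambda * r') / b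
    = r * r' * ((1 - b) / b * lambda ^+ 2 + delta * lambda / eta)
      - m1 * lambda * r'.
  by rewrite /m2; field; rewrite b_neq0 eta_neq0.
have := mulr_ge0 (mulr_ge0 m1_ge0 (ltW lambda_gt0)) (ltW r'_gt0).
rewrite h.
have : r * r' <= r ^+ 2 by rewrite expr2 ler_pM2l.
have := mulr_ge0_le0 (ltW rr') cond_ii.
move: ke; lra.
Qed.

(** Writing [q / eta] as [q + q * delta * r / eta] cancels [q] and most of [q * m2]; the rest is at
    most condition (iii) times [r]. *)
Lemma coef_vv_le0 :
  m1 - m2 + lambda * r / a + (1 + m1 + m2) * (q * (1 - delta * r')) - q / eta
  - kappa * e * (1 + q) <= 0.
Proof.
have := mulr_le0_ge0 cond_iii (ltW r_gt0).
have -> : ((1 + a * (1 - q)) * lambda / a - delta + (1 + q) * (1 / r' - 1 / r)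
  + q * delta ^+ 2 * r' / eta) * r
  = lambda * r / a + lambda * r * (1 - q) - delta * r
    + (1 + q) * m1 + q * delta ^+ 2 * r * r' / eta.
  by rewrite /m1; field; rewrite a_neq0 r_neq0 r'_neq0 eta_neq0.
have m2E : m2 = delta * r / eta - lambda * r by rewrite /m2; field.
have -> : q / eta = q * (1 + delta * r / eta) by rewrite /eta; field.
have h1 := mulr_gt0 (mulr_gt0 kappa_gt0 e_gt0) (addr_gt0 ltr01 q_gt0).
have h2 : delta * r <= delta * r / eta.
  by rewrite ler_pdivlMr// ger_pMr// mulr_gt0.
have h3 : 0 <= q * (delta ^+ 2 * r * r' / eta).
  exact: mulr_ge0 (ltW q_gt0) (ltW (divr_gt0 (mulr_gt0 (mulr_gt0
    (exprn_gt0 2 delta_gt0) r_gt0) r'_gt0) eta_gt0)).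
have h4 : 0 <= q * ((1 + m1 + m2) * (delta * r')).
  exact: mulr_ge0 (ltW q_gt0) (mulr_ge0 (addr_ge0 (addr_ge0 ler01 m1_ge0)
    m2_ge0) (mulr_ge0 (ltW delta_gt0) (ltW r'_gt0))).
move: h1 h2 h3 h4; rewrite m2E.
move: (kappa) (m1) (eta^-1) => K M I; lra.
Qed.

(** The left side is exactly that of condition (iv) times [kappa * s]. *)
Lemma coef_gg_le0 :
  kappa * L * s ^+ 2 * (1 + q + lambda * r') - q * s * (s / eta) <= 0.
Proof.
have -> : s / eta = kappa * (1 - s * e).
  by rewrite /kappa; field; rewrite eta_neq0 gt_eqF.
have : 0 < kappa * s by rewrite mulr_gt0.
move/ltW => ks; have := mulr_ge0_le0 ks cond_iv.
nra.
Qed.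

Context {H : completeNormedModType R} {ip : {dot H for idfun}}.
Context (ip_norm : induces_norm ip).

(** Here [u] is x_k - x_{k-1}, and [F], [F0] are the gaps of phi_k above its minimum at x_{k+1} and
    x_k. Both energies use phi_k and alpha_k; the passage to k+1 is made afterwards. *)
Lemma energy_step (Q v u g d : H) (F F0 : R) :
  eta *: u = v + s *: g -> 0 <= F ->
  F <= (1 - s * e) * ip g Q + L * s ^+ 2 / 2 * `|g| ^+ 2 - e / 2 * `|Q| ^+ 2 ->
  F - F0
    <= (1 - s * e) * ip g v + L * s ^+ 2 / 2 * `|g| ^+ 2 - e / 2 * `|v| ^+ 2 ->
  (1 + (m1 + m2)) * ((1 + q) * kappa * F + 2^-1 * `|(lambda * r') *: Q + v| ^+ 2
                     + q * (1 - delta * r') / 2 * `|v| ^+ 2)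
  - ((1 + q) * kappa * F0 + 2^-1 * `|(lambda * r) *: (Q - v + d) + u| ^+ 2
     + q * eta / 2 * `|u| ^+ 2)
  <= (a + b) * lambda * r / 2 * `|d| ^+ 2.
Proof.
move=> uE F_ge0 hF hF0.
set t' := lambda * r'; set t := lambda * r; set h := s / eta.
have t'0 : 0 < t' by rewrite mulr_gt0.
have t0 : 0 < t by rewrite mulr_gt0.
have hE : h = kappa * (1 - s * e).
  by rewrite /h /kappa; field; rewrite eta_neq0 gt_eqF.
have {}uE : u = eta^-1 *: v + h *: g.
  by rewrite /h mulrC -scalerA -scalerDr -uE scalerA mulVf ?scale1r.
set w := _ + u; set w' := t' *: Q + v.
have wE : w - w' = (m1 * t') *: Q + m2 *: v + h *: g + t *: d.
  have -> : m1 * t' = t - t' by rewrite /m1 /t /t'; field.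
  have -> : m2 = eta^-1 - t - 1 by rewrite /m2 /t /eta; field.
  rewrite /w /w' uE !(scalerDr, scalerBl, scalerN, scale1r, opprD).
  by rewrite [LHS](AC (3*2*2) ((1*6)*(4*2*7)*5*3)).
(* Since the factor of the new energy is [1 + (m1 + m2)], the products <Q, v> in the final sum
   cancel. *)
have := norm2_ge_tangent ip_norm w w'.
rewrite {}wE => sq.
(* Young's inequality for [<d, Q>] and [<d, v>]. *)
have yQ : 0 <= t / b * `|b *: d + t' *: Q| ^+ 2.
  by rewrite mulr_ge0 ?sqr_ge0// ltW// divr_gt0.
have yv : 0 <= t / a * `|a *: d + v| ^+ 2.
  by rewrite mulr_ge0 ?sqr_ge0// ltW// divr_gt0.
have uu : q * eta * `|u| ^+ 2
    = q / eta * ip v v + 2 * q * h * ip g v + q * s * h * ip g g.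
  by rewrite uE (ip_norm2 ip_norm) !ipE (ipC v g) /h; field; exact: eta_neq0.
move: (`|w| ^+ 2) (`|u| ^+ 2) sq uu => W U.
move: yQ yv hF hF0; rewrite /w' !(ip_norm2 ip_norm) !ipE.
rewrite (ipC d Q) (ipC d v) (ipC v Q) (ipC Q g) (ipC v g).
have QQ := coef_QQ_le0; have vv := coef_vv_le0; have gg := coef_gg_le0.
have QQ0 : 0 <= ip Q Q by rewrite ip_norm sqr_ge0.
have vv0 : 0 <= ip v v by rewrite ip_norm sqr_ge0.
have gg0 : 0 <= ip g g by rewrite ip_norm sqr_ge0.
have {}QQ := mulr_le0_ge0 QQ (mulr_ge0 (ltW t'0) QQ0).
have {}vv := mulr_le0_ge0 vv vv0.
have {}gg := mulr_le0_ge0 gg gg0.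
have {QQ0 vv0 gg0} K1 := ler_wpM2r (mulr_ge0 (ltW kappa_gt0) F_ge0) weight_le.
move=> yQ yv hF hF0.
(* These weights turn [1 - s * e] into [h]: <g, Q> then cancels against the tangent term, and <g, v>
   against the tangent term together with [uu]. *)
have {}hF := ler_wpM2l (mulr_ge0 (ltW kappa_gt0) (ltW t'0)) hF.
have q10 : 0 <= 1 + q by rewrite ltW// addr_gt0.
have {}hF0 := ler_wpM2l (mulr_ge0 (ltW kappa_gt0) q10) hF0.
have eh : q * s * (s / eta) = q * s * h by [].
have ts : t / b * (b * (b * ip d d + t' * ip Q d)
                   + t' * (b * ip Q d + t' * ip Q Q))
  = t * b * ip d d + 2 * t * t' * ip Q d + t * t' / b * t' * ip Q Q by field.
have tv : t / a * (a * (a * ip d d + ip v d) + (a * ip v d + ip v v))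
  = t * a * ip d d + 2 * t * ip v d + t / a * ip v v by field.
rewrite ts in yQ; rewrite tv in yv; rewrite eh in gg.
rewrite -/t -/t' in QQ vv gg K1 *.
have kF (X Y : R) : kappa * X * ((1 - s * e) * Y) = X * h * Y.
  by rewrite hE; ring.
rewrite !mulrDr kF in hF.
rewrite !(mulrDr (kappa * (1 + q))) kF in hF0.
move=> sq uu; have tE : (a + b) * lambda * r = (a + b) * t by rewrite /t mulrA.
rewrite tE.
move: (ip Q Q) (ip v v) (ip g g) (ip d d) (ip Q v) (ip g Q) (ip g v) (ip Q d)
  (ip v d) (m1) (m2) (kappa) (h) (t) (t') (q * eta)
  yQ yv hF hF0 QQ vv gg K1 sq uu => *.
lra.
Qed.

End EnergyStep.

(** * Change of regularization parameter and summation *)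

(** Lowering the parameter does not raise the value at [w], and lowers the minimum by at most (e -
    e') / 2 |z'|^2, where |z'| <= |xstar|. *)
Lemma tikhonov_gap_le (R : realType) (H : completeNormedModType R) (f : H -> R)
    (e e' : R) (z z' w xstar : H) :
  0 < e' -> e' <= e -> argmin f xstar ->
  argmin (tikhonov f e) z -> argmin (tikhonov f e') z' ->
  tikhonov f e' w - tikhonov f e' z'
    <= tikhonov f e w - tikhonov f e z + (e - e') / 2 * `|xstar| ^+ 2.
Proof.
move=> e'0 ee' xmin zmin z'min.
have := zmin z'; have := sqr_ge0 `|w|.
have : `|z'| ^+ 2 <= `|xstar| ^+ 2.
  by rewrite lerXn2r ?nnegrE//; exact: tikhonov_argmin_norm e'0 xmin z'min.
rewrite /tikhonov; nra.
Qed.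

(** Multiplying the step by [gamma k] makes it an increment of [gamma k * E k], which telescopes. *)
Lemma discrete_gronwall (R : realType) (E mu theta : nat -> R) (X : R)
    (k0 : nat) (gamma := fun k => \prod_(k0 <= j < k.+1) (1 + mu j)) :
  (forall k, (k0 <= k)%N -> 0 < 1 + mu k) ->
  (forall k, (k0 <= k)%N ->
     E k.+1 - E k + mu k.+1 * E k.+1 <= theta k / 2 * X) ->
  forall k, (k0 <= k)%N ->
    E k.+1 <= gamma k0 / gamma k.+1 * E k0
              + 1 / (2 * gamma k.+1)
                * (\sum_(k0 <= j < k.+1) gamma j * theta j) * X.
Proof.
move=> mu_gt0 step.
have gamma_gt0 k : 0 < gamma k.
  rewrite /gamma big_seq prodr_gt0// => j.
  by rewrite mem_index_iota => /andP[/mu_gt0].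
have gammaS k : (k0 <= k)%N -> gamma k.+1 = gamma k * (1 + mu k.+1).
  by move=> kk; rewrite /gamma big_nat_recr//= leqW.
have key k : (k0 <= k)%N -> gamma k * E k
    <= gamma k0 * E k0 + (\sum_(k0 <= j < k) gamma j * theta j) / 2 * X.
  move=> /subnK <-; elim: (k - k0)%N => [|n IH].
    by rewrite add0n big_geq// !mul0r addr0.
  rewrite addSn gammaS ?leq_addl// big_nat_recr ?leq_addl//=.
  have := ler_wpM2l (ltW (gamma_gt0 (n + k0)%N)) (step _ (leq_addl n k0)).
  move: IH; lra.
move=> k kk; have g0 := gamma_gt0 k.+1.
rewrite -(ler_pM2l g0); apply: le_trans (key k.+1 (leqW kk)) _.
rewrite le_eqVlt; apply/orP; left; apply/eqP.
by field; rewrite gt_eqF.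
Qed.

Lemma mu_ge0 (R : realType) (delta s lambda : R) (eps : nat -> R) (k : nat) :
  0 < delta -> lambda < delta -> 0 < eps k -> eps k <= eps k.-1 ->
  0 < s -> delta * Num.sqrt (s * eps k.-1) < 1 ->
  0 <= mu delta s lambda eps k.
Proof.
move=> delta_gt0 ld e_gt0 ee s_gt0 dr.
rewrite /mu addr_ge0//.
  by rewrite divr_ge0 ?sqrtr_ge0// subr_ge0 ler_wsqrtr.
rewrite mulr_ge0 ?sqrtr_ge0// subr_ge0 ler_pdivlMr ?subr_gt0//.
have := sqrtr_ge0 (s * eps k.-1).
move: (Num.sqrt _) dr => r dr r0.
have : 0 <= delta * r by rewrite mulr_ge0// ltW.
have [l0|l0] := lerP 0 lambda; nra.
Qed.

(** * Assembly along the trajectory *)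

Theorem theorem2p5 (R : realType) (H : completeNormedModType R)
    (ip : {dot H for idfun}) (ip_norm : induces_norm ip)
    (f : H -> R) (gradf : H -> H) (L : R)
    (f_convex : convex_function [set: convex_lmodType H] f)
    (f_grad : is_gradient ip f gradf)
    (L_gt0 : 0 < L)
    (gradf_lip : L.-lipschitz gradf)
    (argmin_neq0 : argmin f !=set0)
    (xstar : H) (xstar_min : min_norm_elts (argmin f) xstar)
    (delta s : R) (delta_gt0 : 0 < delta) (s_gt0 : 0 < s)
    (eps : nat -> R)
    (eps_gt0 : forall k, 0 < eps k)
    (eps_noninc : nonincreasing_seq eps)
    (eps_cvg0 : eps @ \oo --> (0 : R))
    (x : nat -> H) (x_traj : is_trajectory gradf delta s eps x)
    (xeps : nat -> H)
    (xeps_min : forall k, argmin (tikhonov f (eps k)) = [set xeps k])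
    (k0 : nat) (k0_ge1 : (1 <= k0)%N)
    (* positivity of the inertial coefficient, which occurs in denominators *)
    (inertia_gt0 : forall k, (k0 <= k)%N -> delta * Num.sqrt (s * eps k) < 1)
    (a b q lambda : R) (a_gt0 : 0 < a) (b_gt0 : 0 < b) (q_gt0 : 0 < q)
    (lambda_gt0 : 0 < lambda) (lambda_lt : lambda < delta)
    (cond_i : forall k, (k0 <= k)%N ->
      (1 + q) * (1 / Num.sqrt (s * eps k.+1) - 1 / Num.sqrt (s * eps k)
                 + delta / (1 - delta * Num.sqrt (s * eps k)) - lambda)
      - lambda * Num.sqrt (eps k.+1 / eps k) <= 0)
    (cond_ii : forall k, (k0 <= k)%N ->
      (1 - b) / b * lambda ^+ 2
      + delta * lambda / (1 - delta * Num.sqrt (s * eps k)) - 1 <= 0)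
    (cond_iii : forall k, (k0 <= k)%N ->
      (1 + a * (1 - q)) * lambda / a - delta
      + (1 + q) * (1 / Num.sqrt (s * eps k.+1) - 1 / Num.sqrt (s * eps k))
      + q * delta ^+ 2 * Num.sqrt (s * eps k.+1)
        / (1 - delta * Num.sqrt (s * eps k)) <= 0)
    (cond_iv : forall k, (k0 <= k)%N ->
      L * s * (1 + lambda * Num.sqrt (s * eps k.+1))
      + q * ((L + eps k) * s - 1) <= 0) :
  let E := energy delta s q lambda eps f x xeps in
  let mu := mu delta s lambda eps in
  let theta := theta delta s a b q lambda eps in
  let gamma := gam delta s lambda eps k0 in
  (forall k, (k0 <= k)%N ->
     E k.+1 - E k + mu k.+1 * E k.+1 <= theta k / 2 * `|xstar| ^+ 2)
  /\
  (* the term [mu k0] of [gamma] involves the index [k0 - 1] *)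
  (delta * Num.sqrt (s * eps k0.-1) < 1 ->
   forall k, (k0 <= k)%N ->
     E k.+1 <= gamma k0 / gamma k.+1 * E k0
               + 1 / (2 * gamma k.+1)
                 * (\sum_(k0 <= j < k.+1) gamma j * theta j) * `|xstar| ^+ 2).
Proof.
move=> E mu' theta' gamma.
have [xstar_argmin _] := xstar_min.
have zmin k : argmin (tikhonov f (eps k)) (xeps k) by rewrite xeps_min.
have epsS k : eps k.+1 <= eps k by exact: eps_noninc.
have epsP k : eps k <= eps k.-1 by apply: eps_noninc; exact: leq_pred.
have decrease k : (k0 <= k)%N ->
    E k.+1 - E k + mu' k.+1 * E k.+1 <= theta' k / 2 * `|xstar| ^+ 2.
  move=> kk; have k_gt0 : (0 < k)%N by exact: leq_trans kk.
  set r := Num.sqrt (s * eps k); set r' := Num.sqrt (s * eps k.+1).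
  have r'_gt0 : 0 < r' by rewrite sqrtr_gt0 mulr_gt0.
  have r'_le : r' <= r by rewrite ler_wsqrtr// ler_pM2l.
  have rE : r ^+ 2 = s * eps k by rewrite sqr_sqrtr// ltW// mulr_gt0.
  have dr : delta * r < 1 := inertia_gt0 k kk.
  have dr' : delta * r' < 1 := inertia_gt0 k.+1 (leqW kk).
  have sqrtE j : Num.sqrt (s * eps j) = Num.sqrt s * Num.sqrt (eps j).
    by rewrite sqrtrM// ltW.
  have se_neq0 j : Num.sqrt (eps j) != 0 by rewrite gt_eqF// sqrtr_gt0.
  have s_neq0 : Num.sqrt s != 0 by rewrite gt_eqF// sqrtr_gt0.
  have muE : mu' k.+1 = (r - r') / r' + (delta / (1 - delta * r) - lambda) * r.
    rewrite /mu' /mu /= -/r; congr (_ + _).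
    by rewrite /r /r' !sqrtE; field; rewrite s_neq0 se_neq0.
  have c_i := cond_i k kk; have c_ii := cond_ii k kk.
  have c_iii := cond_iii k kk; have c_iv := cond_iv k kk.
  have ratioE : Num.sqrt (eps k.+1 / eps k) = r' / r.
    rewrite sqrtrM ?ltW// sqrtrV ?ltW// /r /r' !sqrtE.
    by field; rewrite s_neq0 se_neq0.
  rewrite ratioE -/r -/r' in c_i; rewrite -/r in c_ii.
  rewrite -/r -/r' in c_iii c_iv.
  have se1 : s * eps k < 1.
    exact: step_lt1 s_gt0 L_gt0 q_gt0 lambda_gt0 r'_gt0 c_iv.
  set y := x k + (1 - delta * r) *: (x k - x k.-1).
  set g := gradf y + eps k *: y.
  have xS : x k.+1 = y - s *: g := x_traj k k_gt0.
  have uE : (1 - delta * r) *: (x k - x k.-1) = (x k.+1 - x k) + s *: g.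
    by rewrite xS /y addrAC subrK addrAC subrr add0r.
  have gs w := tikhonov_gradient_step ip_norm f_grad L_gt0 gradf_lip (eps k) s
    y g (x k.+1) w f_convex erefl xS.
  have F_ge0 : 0 <= tikhonov f (eps k) (x k.+1) - tikhonov f (eps k) (xeps k).
    by rewrite subr_ge0; exact: zmin.
  have gsx := gs (x k).
  have FF0 : tikhonov f (eps k) (x k.+1) - tikhonov f (eps k) (x k)
    = tikhonov f (eps k) (x k.+1) - tikhonov f (eps k) (xeps k)
      - (tikhonov f (eps k) (x k) - tikhonov f (eps k) (xeps k)).
    by rewrite opprB addrA subrK.
  rewrite FF0 in gsx.
  have Qvd : x k.+1 - xeps k - (x k.+1 - x k) + (xeps k - xeps k.-1)
      = x k - xeps k.-1.
    by rewrite opprB (addrC (_ - xeps k)) !subrKA.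
  have := energy_step delta s L (eps k) a b q lambda r r' delta_gt0 s_gt0 L_gt0
    (eps_gt0 k) a_gt0 b_gt0 q_gt0 lambda_gt0 lambda_lt r'_gt0 r'_le rE dr
    c_i c_ii c_iii c_iv ip_norm (x k.+1 - xeps k) (x k.+1 - x k) (x k - x k.-1)
    g (xeps k - xeps k.-1) _ _ uE F_ge0 (gs (xeps k)) gsx.
  rewrite Qvd -muE.
  have alphaE : (1 + q) * (s / ((1 - delta * r) * (1 - s * eps k)))
      = alpha delta s q eps k by rewrite mulrA.
  rewrite alphaE => step.
  (* [step] still weighs the gap of phi_k by [alpha k]. Monotonicity of [alpha] and [gap] replace it
     by the gap of phi_{k+1} weighed by [alpha k.+1], at the cost of the second term of [theta]. *)
  have alpha_le : alpha delta s q eps k.+1 <= alpha delta s q eps k.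
    rewrite /alpha -/r -/r' ler_pM2l; last by rewrite mulr_gt0// addr_gt0.
    rewrite lef_pV2 ?posrE ?mulr_gt0 ?subr_gt0//; last first.
      by rewrite (le_lt_trans _ se1)// ler_pM2l.
    apply: ler_pM; rewrite ?subr_ge0 ?(ltW dr) ?(ltW se1)//.
      by rewrite lerD2l lerN2 ler_pM2l.
    by rewrite lerD2l lerN2 ler_pM2l.
  have alpha_ge0 : 0 <= alpha delta s q eps k.
    apply/ltW/divr_gt0; apply: mulr_gt0; rewrite ?subr_gt0//.
    exact: addr_gt0.
  have gap := tikhonov_gap_le R H f (eps k) (eps k.+1) (xeps k) (xeps k.+1)
    (x k.+1) xstar (eps_gt0 _) (epsS k) xstar_argmin (zmin k) (zmin k.+1).
  have gap_ge0 : 0 <= tikhonov f (eps k.+1) (x k.+1)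
      - tikhonov f (eps k.+1) (xeps k.+1) by rewrite subr_ge0; exact: zmin.
  (* The drift of the viscosity curve, which yields the first term of [theta]. *)
  have d_le : `|xeps k - xeps k.-1| ^+ 2
      <= (eps k - eps k.-1) ^+ 2 / eps k.-1 ^+ 2 * `|xstar| ^+ 2.
    have h := tikhonov_argmin_dist ip_norm f_grad L_gt0 gradf_lip _ _ _ _
      f_convex (eps_gt0 k) (epsP k) (zmin k) (zmin k.-1).
    have nx := tikhonov_argmin_norm (eps k) (xeps k) xstar (eps_gt0 k)
      xstar_argmin (zmin k).
    have {}h := le_trans h (ler_wpM2l (etrans (subr_ge0 _ _) (epsP k)) nx).
    rewrite mulrAC ler_pdivlMr ?exprn_gt0// mulrC -!exprMn.
    have := h; rewrite -(ler_pXn2r (n := 2)) ?nnegrE ?mulr_ge0 ?subr_ge0//.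
      by rewrite !exprMn -(sqrrN (_ - _)) opprB.
    by rewrite ltW.
  have M_ge0 : 0 <= 1 + mu' k.+1.
    by rewrite addr_ge0//; apply: mu_ge0.
  have thetaE : theta' k = (a + b) * lambda * r
        * ((eps k - eps k.-1) ^+ 2 / eps k.-1 ^+ 2)
      + alpha delta s q eps k * (eps k - eps k.+1) * (1 + mu' k.+1).
    by rewrite /theta' /theta /alpha -/r -/mu'; ring.
  rewrite thetaE /E /energy /tau /beta -/r -/r' /=.
  move: step.
  move: (`|_ + (x k.+1 - x k)| ^+ 2) (`|_ + (x k - x k.-1)| ^+ 2) => W' W.
  move: gap gap_ge0 F_ge0 d_le; move: (_ - _) (_ - _) => gap' gap0.
  move=> gap gap'_ge0 _ dl step.
  have abr_ge0 : 0 <= (a + b) * lambda * r / 2.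
    have r_gt0 := lt_le_trans r'_gt0 r'_le.
    exact: ltW (divr_gt0 (mulr_gt0 (mulr_gt0 (addr_gt0 a_gt0 b_gt0) lambda_gt0)
      r_gt0) (ltr0Sn _ 1)).
  have {}dl := ler_wpM2l abr_ge0 dl.
  have := le_trans (ler_wpM2r gap'_ge0 alpha_le) (ler_wpM2l alpha_ge0 gap).
  move/(ler_wpM2l M_ge0); move: dl step.
  move: (alpha _ _ _ _ k) (alpha _ _ _ _ k.+1) (mu' k.+1) (`|xstar| ^+ 2) => *.
  lra.
split=> // dr0; apply: discrete_gronwall => // k kk.
rewrite ltr_pwDl//; apply: mu_ge0 => //.
(* Only [mu k0] looks back to the index [k0.-1], where [dr0] is used. *)
move: kk; rewrite leq_eqVlt => /predU1P[<-//|kk].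
by apply: inertia_gt0; case: (k) kk.
Qed.
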